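(* Let $a\in[0,\tfrac12]$ and $p_1\in[0,\tfrac12)$. Let $X$ be a Bernoulli random variable and let $S=X\oplus S_1$, where $\oplus$ is addition modulo 2, $S_1\sim\mathrm{Bern}(p_1)$ is independent of $X$, and $S\sim\mathrm{Bern}(a)$. For $D\ge 0$ and $C\in[0,1]$ consider $$R(D,C)=\min_{p_{\hat X|X}} I(X;\hat X)\quad\text{s.t.}\quad \mathbb E[\Delta(X,\hat X)]\le D,\quad H(S|\hat X)\le C,$$ where $\Delta$ is the Hamming distortion, $\hat X$ takes values in $\{0,1\}$ and $S-X-\hat X$ is a Markov chain. If $C<H(S_1)$, the problem is infeasible. Otherwise $$R(D,C)=\begin{cases} H(b)-H(C_1) & \text{for } D\ge C_1 \text{ and } C_1\le b,\\ H(b)-H(D) & \text{for } D<C_1 \text{ and } D\le b,\\ 0 & \text{for } \min\{D,C_1\}>b,\end{cases}$$ where $b=\min\left\{\frac{a-p_1}{1-2p_1},\,1-\frac{a-p_1}{1-2p_1}\right\}$ and $C_1=\frac{H^{-1}(C)-p_1}{1-2p_1}$.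
   Context: Entropies and mutual information are in bits. $H(\cdot)$ of a random variable is Shannon entropy; $H(q)$ for a number $q\in[0,1]$ is the binary entropy $-q\log_2 q-(1-q)\log_2(1-q)$. $H^{-1}:[0,1]\to[0,\tfrac12]$ is the inverse of the binary entropy function restricted to $[0,\tfrac12]$. Hamming distortion: $\Delta(x,\hat x)=1$ if $x\ne\hat x$ and $0$ otherwise. The Markov chain condition means that $\hat X$ is generated from $X$ through $p_{\hat X|X}$, conditionally independently of $S$ given $X$. ''Infeasible'' means that no $p_{\hat X|X}$ satisfies the constraints. *)

(* Defs.v *)
From HB Require Import structures.
From mathcomp Require Import all_boot all_order all_algebra.
From mathcomp Require Import all_classical all_reals all_analysis.

Set Implicit Arguments.
Unset Strict Implicit.
Unset Printing Implicit Defensive.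

Import Order.TTheory GRing.Theory Num.Theory.
Import numFieldNormedType.Exports.

Local Open Scope classical_set_scope.
Local Open Scope ring_scope.

(* Since [ln 0 = 0] and [x / 0 = 0], the sums below follow the usual
   convention that terms of probability zero contribute 0. *)
Definition log2 (R : realType) (x : R) : R := ln x / ln 2.

Definition binary_entropy (R : realType) (q : R) : R :=
  - q * log2 q - (1 - q) * log2 (1 - q).

Definition binary_entropy_inv (R : realType) : R -> R :=
  'pinv_(fun=> 0) `[0, 2^-1] (@binary_entropy R).

Section finite_information.
Context {R : realType} {A B : finType}.

Definition push (f : A -> B) (p : A -> R) (b : B) : R :=
  \sum_(a | f a == b) p a.

Definition entropy (p : A -> R) : R := - \sum_a p a * log2 (p a).

Definition marg1 (p : A * B -> R) (a : A) : R := \sum_b p (a, b).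

Definition marg2 (p : A * B -> R) (b : B) : R := \sum_a p (a, b).

Definition mutual_info (p : A * B -> R) : R :=
  \sum_a \sum_b p (a, b) * log2 (p (a, b) / (marg1 p a * marg2 p b)).

End finite_information.

(* H(first component | second component) *)
Definition cond_entropy {R : realType} {A B : finType} (p : A * B -> R) : R :=
  \sum_b marg2 p b * entropy (fun a => p (a, b) / marg2 p b).

Definition law {d} {T : measurableType d} {R : realType} (P : probability T R)
    {A : finType} (Z : T -> A) (z : A) : R := fine (P [set w | Z w = z]).

Definition is_bernoulli {d} {T : measurableType d} {R : realType}
    (P : probability T R) (Z : {RV P >-> bool}) (p : R) : Prop :=
  law P Z =1 bernoulli_pmf p.

Definition independent_RV {d d1 d2} {T : measurableType d}
    {T1 : measurableType d1} {T2 : measurableType d2} {R : realType}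
    (P : probability T R) (Y : {RV P >-> T1}) (Z : {RV P >-> T2}) : Prop :=
  forall (U : set T1) (V : set T2), measurable U -> measurable V ->
    P (Y @^-1` U `&` Z @^-1` V) = (P (Y @^-1` U) * P (Z @^-1` V))%E.

(* [W x y] stands for the transition probability p(y | x). *)
Definition is_channel {R : realType} {A B : finType} (W : A -> B -> R) : Prop :=
  (forall x y, 0 <= W x y) /\ (forall x, \sum_y W x y = 1).

Definition hamming {R : realType} {A : eqType} (x y : A) : R := (x != y)%:R.

Section rate_distortion.
Context {d} {T : measurableType d} {R : realType} (P : probability T R).
Variables S X : {RV P >-> bool}.

(* Law of (S, X, X^) when X^ is drawn from X through W, so that S - X - X^ is a
   Markov chain by construction. *)
Definition joint_law (W : bool -> bool -> R) (t : bool * bool * bool) : R :=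
  let: (s, x, y) := t in law P (fun w => (S w, X w)) (s, x) * W x y.

Definition law_X_Xhat (W : bool -> bool -> R) : bool * bool -> R :=
  push (fun t : bool * bool * bool => (t.1.2, t.2)) (joint_law W).

Definition law_S_Xhat (W : bool -> bool -> R) : bool * bool -> R :=
  push (fun t : bool * bool * bool => (t.1.1, t.2)) (joint_law W).

Definition expected_distortion (W : bool -> bool -> R) : R :=
  \sum_x \sum_y law_X_Xhat W (x, y) * hamming x y.

Definition feasible (D C : R) (W : bool -> bool -> R) : Prop :=
  [/\ is_channel W, expected_distortion W <= D &
      cond_entropy (law_S_Xhat W) <= C].

Definition rates (D C : R) : set R :=
  [set mutual_info (law_X_Xhat W) | W in [set W | feasible D C W]].

(* The minimum defining R(D, C) is attained and equals r. *)
Definition is_rate (D C r : R) : Prop :=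
  rates D C r /\ lbound (rates D C) r.

End rate_distortion.

(* Main.v *)
Require Import Defs.
From HB Require Import structures.
From mathcomp Require Import all_boot all_order all_algebra.
From mathcomp Require Import ring lra.
From mathcomp Require Import all_classical all_reals all_analysis.

Set Implicit Arguments.
Unset Strict Implicit.
Unset Printing Implicit Defensive.

Import Order.TTheory GRing.Theory Num.Theory.
Import numFieldNormedType.Exports.

Local Open Scope classical_set_scope.
Local Open Scope ring_scope.

(* [X] is Bernoulli with parameter [b <= 1/2]. Writing [H(X|X^)] as an average of
   [H(t)] over the posteriors [t] of [X], [I(X;X^) = H(b) - H(X|X^)], while
   [H(S|X^)] is the same average of [H(p1 + (1 - 2 p1) t)], and [H(S|X^) <= C]
   says that this average is at most [H(p1 + (1 - 2 p1) C1)]. Hence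
   [H(X|X^) <= H(C1)] by Mrs. Gerber's lemma, [H(X|X^) <= H(D)] by Fano's
   inequality and [H(X|X^) <= H(b)] by concavity. Each bound is attained by a
   channel whose reverse is binary symmetric with crossover probability [C1], [D]
   or [b]. Mrs. Gerber's lemma comes from a tangent inequality, proved by showing
   that the ratio of the derivatives of [H(p1 + (1 - 2 p1) t)] and [H(t)] is
   nondecreasing on [(0, 1/2)]. *)

(** * Binary entropy and Mrs. Gerber's lemma *)

Section monotonicity.
Context {R : realType}.
Implicit Types (f : R -> R) (x y : R).

(** The derivative is asked for only in the open interval: the binary entropy is continuous at 0 but
    not differentiable there. *)
Lemma is_derive_ge0_le f f' x y : x <= y ->
  (forall t, x < t < y -> is_derive t 1 f (f' t)) ->
  (forall t, x < t < y -> 0 <= f' t) ->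
  {within `[x, y], continuous f} -> f x <= f y.
Proof.
move=> xy df f'0 cf; apply: (ger0_derive1_ndecr _ _ cf) => // t.
- by rewrite in_itv/= => /df[].
- by rewrite in_itv/= derive1E => /[dup] /f'0 + /df[_ ->].
Qed.

Lemma is_derive_gt0_lt f f' x y : x < y ->
  (forall t, x < t < y -> is_derive t 1 f (f' t)) ->
  (forall t, x < t < y -> 0 < f' t) ->
  {within `[x, y], continuous f} -> f x < f y.
Proof.
move=> xy df f'0 cf; apply: (gtr0_derive1_incr _ _ cf) => // t.
- by rewrite in_itv/= => /df[].
- by rewrite in_itv/= derive1E => /[dup] /f'0 + /df[_ ->].
Qed.

Lemma is_derive_within_continuous f f' x y :
  (forall t, x <= t <= y -> is_derive t 1 f (f' t)) ->
  {within `[x, y], continuous f}.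
Proof.
move=> df; apply: derivable_within_continuous => t.
by rewrite in_itv/= => /df[].
Qed.

Lemma is_derive_affine f (a b x df : R) : is_derive (a + b * x) 1 f df ->
  is_derive x 1 (fun t => f (a + b * t)) (b * df).
Proof.
move=> H.
have Hg : is_derive x 1 (fun t : R => a + b * t) b.
  have := is_deriveD (is_derive_cst a x 1) (is_deriveZ b (is_derive_id x 1)).
  by move/is_derive_eq; apply; rewrite add0r [LHS]mulr1.
by rewrite mulrC; exact: (@is_derive1_comp R f (fun t => a + b * t) x df b).
Qed.

End monotonicity.

Section binary_entropy_calculus.
Context {R : realType}.
Implicit Types x y t c p C : R.

Lemma ln2_gt0 : 0 < ln 2 :> R.
Proof. by rewrite ln_gt0// ltr1n. Qed.

(** Modulus of continuity of [x * ln x] at 0. With y the square root of x, [- x * ln x] is 2 y (y ln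
    (1/y)), and ln (1/y) is at most 1/y. *)
Lemma xlnx_le_sqrt x : x <= 1 -> `|x * ln x| <= 2 * Num.sqrt `|x|.
Proof.
move=> x1; have [x0|x0] := leP x 0.
  by rewrite ln0// mulr0 normr0 mulr_ge0.
have y0 : 0 < Num.sqrt x by rewrite sqrtr_gt0.
have yE : Num.sqrt x ^+ 2 = x by rewrite sqr_sqrtr// ltW.
rewrite normrM (gtr0_norm x0) ler0_norm ?ln_le0//.
have -> : - ln x = 2 * ln (Num.sqrt x)^-1.
  by rewrite lnV ?posrE// -[in LHS]yE lnXn//; ring.
have yV0 : 0 < (Num.sqrt x)^-1 by rewrite invr_gt0.
rewrite mulrCA ler_pM2l// -[X in X * ln _]yE expr2 -mulrA.
rewrite -[leRHS]mulr1 ler_pM2l// -ler_pdivlMl// mulr1 ltW//.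
exact: ln_sublinear.
Qed.

(* Holds on the whole line because [ln] vanishes on the nonpositive reals. *)
Lemma continuous_xlnx : continuous (fun x : R => x * ln x).
Proof.
move=> x; have [x0|x0|->] := ltgtP x 0.
- rewrite /continuous_at ln0 ?(ltW x0)// mulr0.
  apply: cvg_near_cst; near=> t.
  have t0 : t < 0 by near: t; exact: lt_nbhsl.
  by rewrite ln0 ?(ltW t0)// mulr0.
- exact: cvgM cvg_id (continuous_ln x0).
- rewrite /continuous_at mul0r; apply/cvgr0Pnorm_le => e e0; near=> t.
  have t1 : t <= 1 by apply/ltW; near: t; exact: lt_nbhsl.
  have te : `|t| <= (e / 2) ^+ 2.
    near: t; apply: cvgr0_norm_le; first exact: cvg_id.
    by rewrite exprn_gt0// divr_gt0.
  rewrite (le_trans (xlnx_le_sqrt t1))// mulrC -ler_pdivlMr//.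
  have <- : Num.sqrt ((e / 2) ^+ 2) = e / 2.
    by rewrite sqrtr_sqr ger0_norm// divr_ge0// ltW.
  exact: ler_wsqrtr.
Unshelve. all: by end_near. Qed.

Lemma continuous_binary_entropy : continuous (@binary_entropy R).
Proof.
move=> x; have -> : @binary_entropy R = fun t =>
    - (t * ln t + (1 - t) * ln (1 - t)) / ln 2.
  by apply/funext => t; rewrite /binary_entropy /log2; field; rewrite gt_eqF ?ln2_gt0.
apply: cvgMr_tmp; apply: cvgN; apply: cvgD; first exact: continuous_xlnx.
apply: (@continuous_comp _ _ _ (fun t : R => 1 - t) (fun t => t * ln t)).
  by apply: cvgB; [exact: cvg_cst|exact: cvg_id].
exact: continuous_xlnx.
Qed.

(** The log-odds with reversed sign: positive on (0, 1/2), and [logit x / ln 2] is the derivative of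
    the binary entropy. *)
Definition logit x : R := ln (1 - x) - ln x.

Lemma is_derive_ln1B x : x < 1 ->
  is_derive x 1 (fun t => ln (1 - t)) (- (1 - x)^-1).
Proof.
move=> x1; have := @is_derive_affine R (@ln R) 1 (-1) x (1 - x)^-1.
rewrite mulN1r => /(_ _)/is_derive_eq.
have -> : (fun t : R => ln (1 + -1 * t)) = (fun t => ln (1 - t)).
  by apply/funext => t; rewrite mulN1r.
apply; last by rewrite mulN1r.
by apply: is_derive1_ln; rewrite subr_gt0.
Qed.

Lemma is_derive_logit x : 0 < x < 1 ->
  is_derive x 1 logit (- (x * (1 - x))^-1).
Proof.
move=> /andP[x0 x1].
have := is_deriveB (is_derive_ln1B x1) (is_derive1_ln x0).
move/is_derive_eq; apply.
by field; rewrite ?gt_eqF ?subr_gt0.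
Qed.

Lemma is_derive_xlnx x : 0 < x -> is_derive x 1 (fun t => t * ln t) (ln x + 1).
Proof.
move=> x0; have := is_deriveM (is_derive_id x 1) (is_derive1_ln x0).
move/is_derive_eq; apply; rewrite /GRing.scale/= mulfV ?gt_eqF//.
by rewrite mulr1 addrC.
Qed.

Lemma is_derive_binary_entropy x : 0 < x < 1 ->
  is_derive x 1 (@binary_entropy R) (logit x / ln 2).
Proof.
move=> /andP[x0 x1].
have H1 := is_derive_xlnx x0.
have := @is_derive_affine R (fun t => t * ln t) 1 (-1) x (ln (1 - x) + 1).
rewrite mulN1r => /(_ (is_derive_xlnx _)).
rewrite subr_gt0 => /(_ x1) H2.
have D := is_deriveZ (- (ln 2)^-1) (is_deriveD H1 H2).
have -> : @binary_entropy R = fun t =>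
    - (ln 2)^-1 * (t * ln t + (1 + -1 * t) * ln (1 + -1 * t)).
  apply/funext => t; rewrite /binary_entropy /log2 mulN1r.
  by field; rewrite gt_eqF ?ln2_gt0.
apply: (is_derive_eq D); rewrite /logit [LHS]/GRing.scale/=.
by field; rewrite gt_eqF ?ln2_gt0.
Qed.

Lemma binary_entropy_sym x : binary_entropy (1 - x) = binary_entropy x.
Proof. by rewrite /binary_entropy (_ : 1 - (1 - x) = x); ring. Qed.

Lemma binary_entropy0 : binary_entropy 0 = 0 :> R.
Proof. by rewrite /binary_entropy /log2 subr0 ln1; ring. Qed.

Lemma binary_entropy1 : binary_entropy 1 = 0 :> R.
Proof. by rewrite -binary_entropy0 -binary_entropy_sym subrr. Qed.

Lemma binary_entropy_half : binary_entropy 2^-1 = 1 :> R.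
Proof.
rewrite /binary_entropy /log2; have -> : 1 - 2^-1 = 2^-1 :> R by lra.
by rewrite lnV ?posrE//; field; rewrite gt_eqF ?ln2_gt0.
Qed.

Lemma logit_gt0 x : 0 < x < 2^-1 -> 0 < logit x.
Proof. by move=> xI; rewrite subr_gt0 ltr_ln ?posrE; lra. Qed.

Lemma binary_entropy_lt x y : 0 <= x -> x < y -> y <= 2^-1 ->
  binary_entropy x < binary_entropy y.
Proof.
move=> x0 xy y2; apply: (is_derive_gt0_lt xy (f' := fun t => logit t / ln 2)).
- by move=> t tI; apply: is_derive_binary_entropy; lra.
- by move=> t tI; rewrite divr_gt0 ?ln2_gt0// logit_gt0//; lra.
- exact: continuous_subspaceT continuous_binary_entropy.
Qed.

Lemma binary_entropy_le x y : 0 <= x -> x <= y -> y <= 2^-1 ->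
  binary_entropy x <= binary_entropy y.
Proof.
move=> x0; rewrite le_eqVlt => /predU1P[->//|xy y2].
by rewrite ltW// binary_entropy_lt.
Qed.

Lemma binary_entropy_le1 x : 0 <= x <= 1 -> binary_entropy x <= 1.
Proof.
move=> xI; rewrite -binary_entropy_half.
have [x2|x2] := leP x 2^-1; first by apply: binary_entropy_le => //; lra.
by rewrite -binary_entropy_sym; apply: binary_entropy_le; lra.
Qed.

Lemma binary_entropy_le_inv x y : 0 <= x <= 2^-1 -> 0 <= y <= 2^-1 ->
  binary_entropy x <= binary_entropy y -> x <= y.
Proof.
move=> xI yI; apply: contraTT; rewrite -!ltNge => yx.
by apply: binary_entropy_lt => //; lra.
Qed.

(** The intermediate value theorem gives a preimage in [0, 1/2] and strict monotonicity makes it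
    unique, so the partial inverse is a genuine one. *)
Lemma binary_entropy_invK C : 0 <= C <= 1 ->
  0 <= binary_entropy_inv C <= 2^-1 /\
  binary_entropy (binary_entropy_inv C) = C.
Proof.
move=> CI; have half0 : (0 : R) <= 2^-1 by lra.
have [||x xI xC] := @IVT R (@binary_entropy R) 0 2^-1 C half0.
- exact: continuous_subspaceT continuous_binary_entropy.
- by rewrite binary_entropy0 binary_entropy_half min_l ?max_r.
have inj : {in `[0, 2^-1]%classic &, injective (@binary_entropy R)}.
  move=> u v; rewrite !inE/= !in_itv/= => uI vI uv.
  by apply/le_anti; rewrite binary_entropy_le_inv ?uv//= binary_entropy_le_inv ?uv.
by rewrite /binary_entropy_inv -xC pinvKV ?inE.
Qed.

(** This is ln u <= u - 1 at u = c / x, multiplied by x. *)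
Lemma gibbs_le x c : 0 <= x -> 0 < c -> x * ln c - x * ln x <= c - x.
Proof.
rewrite le_eqVlt => /predU1P[<- c0|x0 c0]; first by lra.
have cx0 : 0 < c / x by rewrite divr_gt0.
have := @le_ln1Dx R (c / x - 1); rewrite addrCA subrr addr0.
have -> : (-1 < c / x - 1) by lra.
rewrite ln_div ?posrE// => /(_ isT) /(ler_wpM2l (ltW x0)).
by rewrite !mulrBr mulr1 mulrCA mulfV ?mulr1// gt_eqF.
Qed.

(** Adding [gibbs_le] for (x, c) and (1 - x, 1 - c) cancels the linear terms. The bound is affine in
    x with equality at x = c: it is the tangent of the entropy at c. *)
Lemma binary_entropy_le_cross x c : 0 <= x <= 1 -> 0 < c < 1 ->
  binary_entropy x <= - x * log2 c - (1 - x) * log2 (1 - c).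
Proof.
move=> xI cI.
have h1 := @gibbs_le x c; have h2 := @gibbs_le (1 - x) (1 - c).
rewrite /binary_entropy /log2 !mulrA -!mulrBl ler_pM2r ?invr_gt0 ?ln2_gt0//.
rewrite !mulNr; have {}h1 := h1 _ _; have {}h2 := h2 _ _; lra.
Qed.

(** Average the tangent bounds at the mean c of x and y; being affine, they average to the entropy
    of c. *)
Lemma binary_entropy_concave s x y : 0 <= s <= 1 -> 0 <= x <= 1 -> 0 <= y <= 1 ->
  s * binary_entropy x + (1 - s) * binary_entropy y
    <= binary_entropy (s * x + (1 - s) * y).
Proof.
move=> sI xI yI; set c := s * x + _.
have p1 : 0 <= s * x by rewrite mulr_ge0; lra.
have p2 : 0 <= (1 - s) * y by rewrite mulr_ge0; lra.
have p3 : 0 <= s * (1 - x) by rewrite mulr_ge0; lra.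
have p4 : 0 <= (1 - s) * (1 - y) by rewrite mulr_ge0; lra.
have cE : 1 - c = s * (1 - x) + (1 - s) * (1 - y) by rewrite /c; ring.
(* The tangent exists only for 0 < c < 1. If c is 0 or 1, every point of positive weight equals c,
   and both sides vanish. *)
have [c0|c0] := leP c 0.
  have /eqP : s * x = 0 by rewrite /c in c0; lra.
  have /eqP : (1 - s) * y = 0 by rewrite /c in c0; lra.
  have -> : c = 0 by rewrite /c in c0 *; lra.
  by rewrite !mulf_eq0 => /predU1P[->|/eqP->] /predU1P[->|/eqP->];
    rewrite ?binary_entropy0 ?mul0r ?mulr0 ?addr0.
have [c1|c1] := leP 1 c.
  have /eqP : s * (1 - x) = 0 by lra.
  have /eqP : (1 - s) * (1 - y) = 0 by lra.
  have -> : c = 1 by lra.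
  by rewrite !mulf_eq0 => /predU1P[->|]; [|rewrite subr_eq0 => /eqP<-];
    move=> /predU1P[->|]; do ?[rewrite subr_eq0 => /eqP<-];
    rewrite ?binary_entropy1 ?mul0r ?mulr0 ?addr0.
have h1 := @binary_entropy_le_cross x c xI.
have h2 := @binary_entropy_le_cross y c yI.
have {}h1 := h1 (introT andP (conj c0 c1)).
have {}h2 := h2 (introT andP (conj c0 c1)).
have s0 : 0 <= s by lra.
have s1 : 0 <= 1 - s by lra.
apply: le_trans (lerD (ler_wpM2l s0 h1) (ler_wpM2l s1 h2)) _.
by rewrite /binary_entropy /c le_eqVlt; apply/orP; left; apply/eqP; ring.
Qed.

(** * Tangent inequality and Mrs. Gerber's lemma *)

Lemma logit_half : logit 2^-1 = 0 :> R.
Proof. by rewrite /logit (_ : 1 - 2^-1 = 2^-1) ?subrr//; lra. Qed.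

(** The left side is the tangent of [logit] at 1/2. The difference vanishes at 1/2, and its
    derivative has constant sign because t (1 - t) <= 1/4. *)
Lemma logit_ge t : 0 < t < 2^-1 -> 2 * (1 - 2 * t) <= logit t.
Proof.
move=> tI; have tle : t <= 2^-1 by lra.
pose g' (s : R) := - 4 + (s * (1 - s))^-1.
have dg (s : R) : 0 < s < 1 -> is_derive s 1 (fun s => 2 * (1 - 2 * s) - logit s) (g' s).
  move=> sI.
  have D1 := @is_derive_affine R (@id R) 2 (-4) s 1 (is_derive_id _ _).
  have -> : (fun s : R => 2 * (1 - 2 * s) - logit s) = fun s => (2 + -4 * s) - logit s.
    by apply/funext => r; ring.
  by apply: (is_derive_eq (is_deriveB D1 (is_derive_logit sI))); rewrite /g'; ring.
have := @is_derive_ge0_le R (fun s => 2 * (1 - 2 * s) - logit s) g' t 2^-1 tle.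
rewrite logit_half (_ : 2 * (1 - 2 * 2^-1) - 0 = 0); last by field.
rewrite subr_le0; apply.
- by move=> s sI; apply: dg; lra.
- move=> s sI; rewrite /g'.
  have s0 : 0 < s * (1 - s) by rewrite mulr_gt0; lra.
  rewrite addrC subr_ge0 -[leLHS]invrK lef_pV2 ?posrE ?invr_gt0//.
  by rewrite -subr_ge0 (_ : _ - _ = (s - 2^-1) ^+ 2) ?sqr_ge0//; field.
- by apply: (is_derive_within_continuous (f' := g')) => s sI; apply: dg; lra.
Qed.

(* The derivative of the ratio in [logit_ratio_le] is nonnegative exactly when
   [t (1 - t) logit t / (1 - 2 t)] does not decrease from [t] to [cascade p t]. *)
Lemma logit_scaled_le x y : 0 < x -> x <= y -> y < 2^-1 ->
  x * (1 - x) * logit x / (1 - 2 * x) <= y * (1 - y) * logit y / (1 - 2 * y).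
Proof.
move=> x0 xy y2.
pose f' (t : R) := ((1 - 2 * t + 2 * t ^+ 2) * logit t - (1 - 2 * t)) / (1 - 2 * t) ^+ 2.
have df (t : R) : 0 < t < 2^-1 ->
    is_derive t 1 (fun t => t * (1 - t) * logit t / (1 - 2 * t)) (f' t).
  move=> tI; have tI1 : 0 < t < 1 by lra.
  have t1 : 1 + -2 * t != 0 by lra.
  have D1 := is_deriveM (is_derive_id t 1)
    (@is_derive_affine R (@id R) 1 (-1) t 1 (is_derive_id _ _)).
  have D2 := is_deriveM D1 (is_derive_logit tI1).
  have D3 := is_deriveM D2 (@is_deriveV R (fun r => 1 + -2 * r) t _ 1 t1
    (@is_derive_affine R (@id R) 1 (-2) t 1 (is_derive_id _ _))).
  have -> : (fun t : R => t * (1 - t) * logit t / (1 - 2 * t)) =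
      fun t : R => t * (1 + -1 * t) * logit t * (1 + -2 * t)^-1.
    by apply/funext => r; rewrite mulN1r mulNr.
  apply: (is_derive_eq D3).
  change (t * (1 + -1 * t) * logit t * (- (1 + -2 * t) ^- 2 * (-2 * 1)) +
    (1 + -2 * t)^-1 * (t * (1 + -1 * t) * - (t * (1 - t))^-1 +
      logit t * (t * (-1 * 1) + (1 + -1 * t) * 1)) = f' t).
  rewrite /f'.
  by field; rewrite !gt_eqF; lra.
apply: (@is_derive_ge0_le R (fun t => t * (1 - t) * logit t / (1 - 2 * t)) f' x y xy).
- by move=> t tI; apply: df; lra.
(* In the numerator, the factor of [logit t] is at least 1/2 and [logit t] is at least 2 (1 - 2 t)
   by [logit_ge]. *)
- move=> t tI; rewrite /f' divr_ge0 ?sqr_ge0// subr_ge0.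
  have h : 2 * (1 - 2 * t) <= logit t by apply: logit_ge; lra.
  have h0 : 0 < 1 - 2 * t by lra.
  have h1 : 0 <= t ^+ 2 by rewrite sqr_ge0.
  have h2 : 2^-1 <= 1 - 2 * t + 2 * t ^+ 2.
    have := sqr_ge0 (t - 2^-1); rewrite sqrrB expr2; lra.
  have h3 : 2^-1 * logit t <= (1 - 2 * t + 2 * t ^+ 2) * logit t.
    by rewrite ler_pM2r//; lra.
  lra.
- by apply: (is_derive_within_continuous (f' := f')) => t tI; apply: df; lra.
Qed.

(* Crossover probability of the cascade of binary symmetric channels with
   crossover probabilities [p] and [t]. *)
Definition cascade p t : R := p + (1 - 2 * p) * t.

Lemma cascadeB p t : cascade p (1 - t) = 1 - cascade p t.
Proof. by rewrite /cascade; ring. Qed.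

(** Up to the factor 1 - 2 p, this is the ratio of the derivatives of H(cascade p t) and H(t). *)
Lemma logit_ratio_le p x y : 0 <= p < 2^-1 -> 0 < x -> x <= y -> y < 2^-1 ->
  logit (cascade p x) / logit x <= logit (cascade p y) / logit y.
Proof.
move=> pI x0 xy y2; pose k := 1 - 2 * p.
pose f' (t : R) := (logit (cascade p t) / (t * (1 - t)) -
   k * logit t / (cascade p t * (1 - cascade p t))) / logit t ^+ 2.
have cI (t : R) : 0 < t < 2^-1 -> t <= cascade p t < 2^-1.
  move=> tI; have : 0 <= p * (1 - 2 * t) by rewrite mulr_ge0; lra.
  have : 0 < (1 - 2 * p) * (2^-1 - t) by rewrite mulr_gt0; lra.
  rewrite /cascade; lra.
have df (t : R) : 0 < t < 2^-1 ->
    is_derive t 1 (fun t => logit (cascade p t) / logit t) (f' t).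
  move=> tI; have ctI := cI t tI.
  have l0 : 0 < logit t by apply: logit_gt0.
  have D1 := @is_derive_affine R logit p k t _ (@is_derive_logit (cascade p t) _).
  have {}D1 := D1 ltac:(lra).
  have D2 := is_deriveV (lt0r_neq0 l0) (@is_derive_logit t _).
  have {}D2 := D2 ltac:(lra).
  apply: (is_derive_eq (is_deriveM D1 D2)).
  rewrite /f' /GRing.scale/= -/(cascade p t).
  by field; rewrite !gt_eqF; lra.
apply: (@is_derive_ge0_le R (fun t => logit (cascade p t) / logit t) f' x y xy).
- by move=> t tI; apply: df; lra.
- move=> t tI; rewrite /f' divr_ge0 ?sqr_ge0// subr_ge0.
  have := cI t; set u := cascade p t => uI; have {}uI := uI ltac:(lra).
  have k0 : 0 < k by rewrite /k; lra.
  have u0 : 0 < u * (1 - u) by rewrite mulr_gt0; lra.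
  have t0 : 0 < t * (1 - t) by rewrite mulr_gt0; lra.
  have := @logit_scaled_le t u ltac:(lra) ltac:(lra) ltac:(lra).
  (* This identity cancels [k] and reduces the sign of [f'] to [logit_scaled_le] between t and u. *)
  have -> : 1 - 2 * u = k * (1 - 2 * t) by rewrite /u /cascade /k; ring.
  have t1 : 0 < 1 - 2 * t by lra.
  rewrite invfM mulrA ler_pM2r ?invr_gt0// ler_pdivlMr// => h.
  rewrite ler_pdivrMr// mulrAC ler_pdivlMr//; lra.
- by apply: (is_derive_within_continuous (f' := f')) => t tI; apply: df; lra.
Qed.

(* By [logit_ratio_le] the derivative of
   [t |-> H(cascade p t) - lam * H(t)] has the sign of [t - c]. *)
Lemma gerber_tangent p c : 0 <= p < 2^-1 -> 0 < c < 2^-1 ->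
  exists2 lam : R, 0 < lam & forall t, 0 <= t <= 1 ->
    lam * (binary_entropy t - binary_entropy c)
      <= binary_entropy (cascade p t) - binary_entropy (cascade p c).
Proof.
move=> pI cI; pose k := 1 - 2 * p.
have k0 : 0 < k by rewrite /k; lra.
pose rho (t : R) := logit (cascade p t) / logit t.
have ccI (t : R) : 0 < t < 2^-1 -> 0 < cascade p t < 2^-1.
  move=> tI; have : 0 < (1 - 2 * p) * t by rewrite mulr_gt0; lra.
  have : 0 < (1 - 2 * p) * (2^-1 - t) by rewrite mulr_gt0; lra.
  rewrite /cascade; lra.
have rho0 : 0 < rho c by rewrite divr_gt0// logit_gt0// ccI.
(* The ratio of the two derivatives at c, which makes [psi] below stationary there. *)
exists (k * rho c) => [|t]; first exact: mulr_gt0.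
pose psi (t : R) := binary_entropy (cascade p t) - k * rho c * binary_entropy t.
(* [psi] is invariant under t -> 1 - t, so the half interval suffices. *)
suff H (s : R) : 0 <= s <= 2^-1 -> psi c <= psi s.
  move=> tI; suff : psi c <= psi t by rewrite /psi; lra.
  have [t2|t2] := leP t 2^-1; first by apply: H; lra.
  have -> : psi t = psi (1 - t).
    by rewrite /psi cascadeB !binary_entropy_sym.
  by apply: H; lra.
move=> sI.
pose psi' (t : R) := k * logit t * (rho t - rho c) / ln 2.
have l2 := ln2_gt0.
have dpsi (r : R) : 0 < r < 2^-1 -> is_derive r 1 psi (psi' r).
  move=> rI; have crI := ccI r rI.
  have l0 : 0 < logit r by apply: logit_gt0.
  have D1 := @is_derive_affine R (@binary_entropy R) p k r _
    (@is_derive_binary_entropy (cascade p r) ltac:(lra)).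
  have D2 := is_deriveZ (k * rho c) (@is_derive_binary_entropy r ltac:(lra)).
  apply: (is_derive_eq (is_deriveB D1 D2)).
  rewrite /psi' /GRing.scale/= [in rho r]/rho.
  by field; rewrite !gt_eqF//; lra.
have cpsi : continuous psi.
  move=> r; apply: cvgB; last by apply: cvgMl_tmp; exact: continuous_binary_entropy.
  apply: (@continuous_comp _ _ _ (cascade p) (@binary_entropy R)).
    by apply: cvgD; [exact: cvg_cst|apply: cvgMl_tmp; exact: cvg_id].
  exact: continuous_binary_entropy.
have [cs|sc] := leP c s.
  apply: (@is_derive_ge0_le R psi psi' c s cs) => [r rI|r rI|].
  - by apply: dpsi; lra.
  - rewrite /psi' divr_ge0 ?(ltW l2)// mulr_ge0//.
      by rewrite mulr_ge0 ?(ltW k0)// ltW// logit_gt0//; lra.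
    by rewrite subr_ge0; apply: logit_ratio_le => //; lra.
  - exact: continuous_subspaceT.
rewrite -lerN2.
apply: (@is_derive_ge0_le R (- psi) (- psi') s c (ltW sc)) => [r rI|r rI|].
- by apply: is_deriveN; apply: dpsi; lra.
- rewrite /psi' [X in _ <= X]/GRing.opp/= -mulNr divr_ge0 ?(ltW l2)// -mulrN mulr_ge0//.
    by rewrite mulr_ge0 ?(ltW k0)// ltW// logit_gt0//; lra.
  by rewrite opprB subr_ge0; apply: logit_ratio_le => //; lra.
- by apply: continuous_subspaceT => r; apply: cvgN; exact: cpsi.
Qed.

Lemma cascade_ge0le1 p t : 0 <= p < 2^-1 -> 0 <= t <= 1 ->
  p <= cascade p t <= 1 - p.
Proof.
move=> pI tI; have : 0 <= (1 - 2 * p) * t by rewrite mulr_ge0; lra.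
have : 0 <= (1 - 2 * p) * (1 - t) by rewrite mulr_ge0; lra.
rewrite /cascade; lra.
Qed.

(** The cascade stays in [p, 1 - p], where the entropy is smallest at the ends. This yields
    infeasibility below H(S1). *)
Lemma binary_entropy_cascade_ge p t : 0 <= p < 2^-1 -> 0 <= t <= 1 ->
  binary_entropy p <= binary_entropy (cascade p t).
Proof.
move=> pI tI; have cI := cascade_ge0le1 pI tI.
have [c2|c2] := leP (cascade p t) 2^-1; first by apply: binary_entropy_le; lra.
by rewrite -[leRHS]binary_entropy_sym; apply: binary_entropy_le; lra.
Qed.

(** Averaging [gerber_tangent] at x and y bounds [lam] times the difference of the conclusion's
    sides by a nonpositive number. *)
Lemma mrs_gerber_le p c s x y : 0 <= p < 2^-1 -> 0 <= c <= 2^-1 ->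
  0 <= s <= 1 -> 0 <= x <= 1 -> 0 <= y <= 1 ->
  s * binary_entropy (cascade p x) + (1 - s) * binary_entropy (cascade p y)
    <= binary_entropy (cascade p c) ->
  s * binary_entropy x + (1 - s) * binary_entropy y <= binary_entropy c.
Proof.
move=> pI cI sI xI yI.
set G := s * binary_entropy x + _; set K := s * binary_entropy _ + _ => Kc.
have G1 : G <= 1.
  have s0 : 0 <= s by lra.
  have s1 : 0 <= 1 - s by lra.
  have h1 := ler_wpM2l s0 (binary_entropy_le1 xI).
  have h2 := ler_wpM2l s1 (binary_entropy_le1 yI).
  rewrite /G; lra.
(* Stated for every interior c' above c, since c = 0 has to be approached from the right. *)
have interior (c' : R) : c <= c' -> 0 < c' < 2^-1 -> G <= binary_entropy c'.
  move=> cc' c'I; have [lam lam0 tang] := gerber_tangent pI c'I.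
  have s0 : 0 <= s by lra.
  have s1 : 0 <= 1 - s by lra.
  have h1 := ler_wpM2l s0 (tang x xI).
  have h2 := ler_wpM2l s1 (tang y yI).
  have h3 : binary_entropy (cascade p c) <= binary_entropy (cascade p c').
    have h4 : 0 <= (1 - 2 * p) * c by rewrite mulr_ge0; lra.
    have h5 : 0 <= (1 - 2 * p) * (c' - c) by rewrite mulr_ge0; lra.
    have h6 : 0 < (1 - 2 * p) * (2^-1 - c') by rewrite mulr_gt0; lra.
    by apply: binary_entropy_le; rewrite /cascade; lra.
  have : lam * (G - binary_entropy c') <= 0.
    apply: (@le_trans _ _ (K - binary_entropy (cascade p c'))); last by lra.
    rewrite /K /G; lra.
  by rewrite pmulr_rle0// subr_le0.
have [c2|c2] := leP 2^-1 c.
  by have -> : c = 2^-1 by [lra]; rewrite binary_entropy_half.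
have [c0|c0] := ltP 0 c; first by apply: interior => //; lra.
have {c0 c2} c0 : c = 0 by lra.
(* There is no tangent at [c = 0]; use an interior point where the entropy is
   below [G]. *)
rewrite c0 binary_entropy0 leNgt; apply/negP => G0.
have [c'I c'E] := @binary_entropy_invK (G / 2) ltac:(lra).
move: c'I c'E; set c' := binary_entropy_inv _ => c'I c'E.
have c'0 : c' != 0.
  by apply: contra_eq_neq c'E => ->; rewrite binary_entropy0; lra.
have c'2 : c' != 2^-1.
  by apply: contra_eq_neq c'E => ->; rewrite binary_entropy_half; lra.
have := interior c' ltac:(lra); rewrite c'E.
have -> : 0 < c' < 2^-1 by rewrite !lt_neqAle eq_sym c'0 c'2.
by move=> /(_ isT); lra.
Qed.

End binary_entropy_calculus.

(** * Information measures *)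

Section finite_information.
Context {R : realType}.

(** The logarithm splits term by term: a positive [p (a, b)] forces both marginals to be positive,
    and a zero one contributes nothing to either side. *)
Lemma mutual_infoE {A B : finType} (p : A * B -> R) : (forall ab, 0 <= p ab) ->
  mutual_info p = entropy (marg1 p) - cond_entropy p.
Proof.
move=> p0.
have le1 a b : p (a, b) <= marg1 p a.
  by rewrite /marg1 (bigD1 b)//= lerDl sumr_ge0.
have le2 a b : p (a, b) <= marg2 p b.
  by rewrite /marg2 (bigD1 a)//= lerDl sumr_ge0.
have -> : entropy (marg1 p) =
    - \sum_a \sum_b p (a, b) * log2 (marg1 p a).
  by congr (- _); apply: eq_bigr => a _; rewrite -mulr_suml.
have -> : cond_entropy p =
    - \sum_a \sum_b p (a, b) * log2 (p (a, b) / marg2 p b).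
  rewrite exchange_big/= -sumrN; apply: eq_bigr => b _.
  rewrite /entropy mulrN; congr (- _); rewrite mulr_sumr; apply: eq_bigr => a _.
  have [m0|m0] := eqVneq (marg2 p b) 0.
    have -> : p (a, b) = 0 by apply/le_anti; rewrite p0 -m0 le2.
    by rewrite !mul0r mulr0.
  by rewrite mulrA (mulrC (marg2 p b)) divfK.
rewrite opprK addrC -sumrB; apply: eq_bigr => a _.
rewrite -sumrB; apply: eq_bigr => b _.
have [->|pab] := eqVneq (p (a, b)) 0; first by rewrite !mul0r subr0.
have ppos : 0 < p (a, b) by rewrite lt_neqAle eq_sym pab p0.
have m1 := lt_le_trans ppos (le1 a b).
have m2 := lt_le_trans ppos (le2 a b).
rewrite -mulrBr /log2 -mulrBl -ln_div ?posrE ?divr_gt0//.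
by congr (_ * (ln _ / _)); rewrite invfM mulrA mulrAC.
Qed.

Lemma entropy_bool (q : bool -> R) : q true + q false = 1 ->
  entropy q = binary_entropy (q true).
Proof.
move=> q1; have -> : q true = 1 - q false by lra.
rewrite /entropy big_bool/= /binary_entropy subKr.
have -> : q true = 1 - q false by lra.
by ring.
Qed.

Lemma cond_entropy_bool {B : finType} (p : bool * B -> R) :
  cond_entropy p =
  \sum_b marg2 p b * binary_entropy (p (true, b) / marg2 p b).
Proof.
apply: eq_bigr => b _.
have [->|m0] := eqVneq (marg2 p b) 0; first by rewrite !mul0r.
rewrite entropy_bool// -mulrDl; suff -> : p (true, b) + p (false, b) = marg2 p b.
  exact: mulfV.
by rewrite /marg2 big_bool.
Qed.

End finite_information.

(** * Test channels *)

Section laws.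
Context {d} {T : measurableType d} {R : realType} (P : probability T R).

Lemma law_ge0 {A : finType} (Z : T -> A) z : 0 <= law P Z z.
Proof. by rewrite fine_ge0. Qed.

Lemma measurable_RV_eq (Z : {RV P >-> bool}) z :
  measurable [set w | Z w = z].
Proof.
rewrite (_ : [set w | Z w = z] = setT `&` Z @^-1` [set z]); last by rewrite setTI.
exact: (measurable_funPT Z).
Qed.

Lemma fineD_disjoint (U V : set T) : measurable U -> measurable V ->
  U `&` V = set0 -> fine (P (U `|` V)) = fine (P U) + fine (P V).
Proof.
move=> mU mV UV; rewrite measureU// fineD//.
- exact: fin_num_measure.
- exact: fin_num_measure.
Qed.

Lemma law_RV_sum (Z : {RV P >-> bool}) : law P Z true + law P Z false = 1.
Proof.
rewrite /law -fineD_disjoint; first last.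
- by apply/seteqP; split => [w [/= -> //]|].
- exact: measurable_RV_eq.
- exact: measurable_RV_eq.
rewrite (_ : _ `|` _ = setT) ?probability_setT//.
by apply/seteqP; split => // w _ /=; case: (Z w); [left|right].
Qed.

Context {X S1 S : {RV P >-> bool}}.
Hypothesis hS : forall w, S w = X w (+) S1 w.
Hypothesis hindep : independent_RV X S1.

(** Given X = x, the event S = s is S1 = s + x modulo 2, so independence factors the joint event. *)
Lemma law_pair_xor s x :
  law P (fun w => (S w, X w)) (s, x) = law P X x * law P S1 (s (+) x).
Proof.
rewrite /law -fineM; last 2 first.
- exact/fin_num_measure/measurable_RV_eq.
- exact/fin_num_measure/measurable_RV_eq.
have := hindep (U := [set x]) (V := [set s (+) x]) => /(_ I I) <-.
congr (fine (P _)); apply/seteqP; split => w /=.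
  by move=> [<- <-]; rewrite hS; split => //; case: (X w); case: (S1 w).
by move=> [<- h]; rewrite hS h; congr pair; case: (X w); case: s {h}.
Qed.

Lemma law_xor s : law P S s =
  law P X true * law P S1 (~~ s) + law P X false * law P S1 s.
Proof.
have -> : ~~ s = s (+) true by case: s.
rewrite -[in X in _ + X](addbF s) -!law_pair_xor /law -fineD_disjoint.
- congr (fine (P _)); apply/seteqP; split => w /=.
    by move=> ->; case: (X w); [left|right].
  by move=> [] [].
- rewrite (_ : mkset _ = [set w | S w = s] `&` [set w | X w = true]).
    by apply: measurableI; exact: measurable_RV_eq.
  by apply/seteqP; split => w /= [-> ->].
- rewrite (_ : mkset _ = [set w | S w = s] `&` [set w | X w = false]).
    by apply: measurableI; exact: measurable_RV_eq.
  by apply/seteqP; split => w /= [-> ->].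
- by apply/seteqP; split => w //= [[_ ->]].
Qed.

Lemma big_bool3 (F : bool * bool * bool -> R) :
  \sum_t F t = \sum_s \sum_x \sum_y F (s, x, y).
Proof.
rewrite (pair_bigA _ (fun s x => \sum_y F (s, x, y)))/=.
rewrite (pair_bigA _ (fun u y => F (u.1, u.2, y)))/=.
by apply: eq_bigr => -[[s x] y].
Qed.

Variable W : bool -> bool -> R.

Lemma law_X_XhatE x y : law_X_Xhat S X W (x, y) = law P X x * W x y.
Proof.
have := law_RV_sum S1.
rewrite /law_X_Xhat /push big_mkcond big_bool3 !big_bool /joint_law.
rewrite !law_pair_xor => h1.
have h0 : law P S1 true = 1 - law P S1 false by lra.
by case: x; case: y; rewrite /= h0; ring.
Qed.

Lemma law_S_XhatE s y : law_S_Xhat S X W (s, y) =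
  law P X true * W true y * law P S1 (~~ s) + law P X false * W false y * law P S1 s.
Proof.
rewrite /law_S_Xhat /push big_mkcond big_bool3 !big_bool /joint_law.
rewrite !law_pair_xor.
by case: s; case: y => /=; ring.
Qed.

End laws.

Lemma is_bernoulli_ge0le1 {d} {T : measurableType d} {R : realType}
    (P : probability T R) (Z : {RV P >-> bool}) (q : R) :
  is_bernoulli Z q -> 0 <= q <= 1.
Proof.
move=> hZ; have := law_ge0 P Z true; have := law_ge0 P Z false.
by rewrite !hZ/=; lra.
Qed.

(** * Rate, distortion and leakage in terms of posteriors *)

Section channels.
Context {d} {T : measurableType d} {R : realType} (P : probability T R).
Context {X S1 S : {RV P >-> bool}} (b p : R).
Hypothesis hS : forall w, S w = X w (+) S1 w.
Hypothesis hindep : independent_RV X S1.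
Hypothesis hp : 0 <= p < 2^-1.
Hypothesis hS1 : is_bernoulli S1 p.

Hypothesis hX : is_bernoulli X b.

(* The output of the channel [W] is 1 with probability [s], and the posterior
   probability of [X = 1] given the output is [x] or [y] according to whether the
   output is 1 or 0. *)
Definition has_posteriors (W : bool -> bool -> R) (s x y : R) :=
  [/\ b * W true true = s * x, (1 - b) * W false true = s * (1 - x),
      b * W true false = (1 - s) * y &
      (1 - b) * W false false = (1 - s) * (1 - y)].

(** Bayes' rule. For an output of probability zero the quotient is 0 by convention, and the product
    form of [has_posteriors] still holds. *)
Lemma channel_has_posteriors W : is_channel W -> exists s x y : R,
  [/\ 0 <= s <= 1, 0 <= x <= 1, 0 <= y <= 1 & has_posteriors W s x y].
Proof.
move=> [W0 W1]; have bI := is_bernoulli_ge0le1 hX.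
have W1t := W1 true; have W1f := W1 false.
rewrite !big_bool/= in W1t W1f.
have nonneg u v : (0 : R) <= bernoulli_pmf b u * W u v.
  by rewrite mulr_ge0//; case: u => /=; lra.
have qtt := nonneg true true; have qft := nonneg false true.
have qtf := nonneg true false; have qff := nonneg false false.
rewrite /= in qtt qft qtf qff.
have posterior (u v : R) : 0 <= u -> 0 <= v -> 0 <= u / (u + v) <= 1 /\
    u = (u + v) * (u / (u + v)).
  move=> u0 v0; have [uv0|uv0] := eqVneq (u + v) 0.
    have -> : u = 0 by lra.
    by rewrite !mul0r mulr0 lexx ler01.
  have uvgt0 : 0 < u + v by rewrite lt_neqAle eq_sym uv0/=; lra.
  rewrite divr_ge0 ?(ltW uvgt0)//= ler_pdivrMr// mul1r lerDl v0.
  by rewrite mulrC divfK.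
have [xI xE] := posterior _ _ qtt qft.
have [yI yE] := posterior _ _ qtf qff.
move: xI xE yI yE; set x := _ / _ => xI xE; set y := _ / _ => yI yE.
have sum1 : b * W true true + (1 - b) * W false true +
    (b * W true false + (1 - b) * W false false) = 1.
  have -> : W true false = 1 - W true true by lra.
  have -> : W false false = 1 - W false true by lra.
  by ring.
exists (b * W true true + (1 - b) * W false true), x, y.
split => //; first by lra.
have yE' : b * W true false + (1 - b) * W false false =
  1 - (b * W true true + (1 - b) * W false true) by lra.
by split => //; rewrite -?yE' // mulrBr mulr1; lra.
Qed.

Lemma has_posteriors_channel (s x y : R) : 0 <= s <= 1 -> 0 <= x <= 1 -> 0 <= y <= 1 ->
  s * x + (1 - s) * y = b -> exists2 W, is_channel W & has_posteriors W s x y.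
Proof.
move=> sI xI yI bE.
have h1 : 0 <= s * x by rewrite mulr_ge0; lra.
have h2 : 0 <= (1 - s) * y by rewrite mulr_ge0; lra.
have h3 : 0 <= s * (1 - x) by rewrite mulr_ge0; lra.
have h4 : 0 <= (1 - s) * (1 - y) by rewrite mulr_ge0; lra.
have bE' : s * (1 - x) + (1 - s) * (1 - y) = 1 - b by rewrite -bE; ring.
have split_ratio (u v w : R) : 0 <= u -> 0 <= v -> u + v = w ->
    exists2 f : bool -> R, (forall z, 0 <= f z) /\ f true + f false = 1 &
      w * f true = u /\ w * f false = v.
  move=> u0 v0 <-; have [uv0|uv0] := eqVneq (u + v) 0.
    (* An input of probability zero leaves its row free; a point mass at [true] is chosen. *)
    exists (fun z => z%:R); first by split; [case|rewrite addr0].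
    by rewrite uv0 !mul0r; split; lra.
  exists (fun z => (if z then u else v) / (u + v)).
    split; last by rewrite -mulrDl mulfV.
    by case; rewrite divr_ge0// addr_ge0.
  by split; rewrite mulrC divfK.
have [f [f0 f1] [ft ff]] := split_ratio _ _ _ h1 h2 bE.
have [g [g0 g1] [gt gf]] := split_ratio _ _ _ h3 h4 bE'.
exists (fun u => if u then f else g); last by [].
by split => [[]//|[]]; rewrite big_bool.
Qed.

Section evaluation.
Variables (W : bool -> bool -> R) (s x y : R).
Hypothesis sxy : has_posteriors W s x y.

Let qE u v : law_X_Xhat S X W (u, v) =
  (if v then s else 1 - s) * bernoulli_pmf (if v then x else y) u.
Proof.
by rewrite (law_X_XhatE hS hindep) hX; case: sxy; case: u; case: v.
Qed.

Let mE v : marg2 (law_X_Xhat S X W) v = if v then s else 1 - s.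
Proof. by rewrite /marg2 big_bool/= !qE/= -mulrDr subrKC mulr1. Qed.

Lemma distortion_posteriors :
  expected_distortion S X W = s * (1 - x) + (1 - s) * y.
Proof.
by rewrite /expected_distortion !big_bool/= !qE /hamming/=; ring.
Qed.

(** Given the output, X is Bernoulli with the posterior as parameter, and adding the independent S1
    passes that parameter through [cascade p]. *)
Lemma cond_entropy_S_posteriors :
  cond_entropy (law_S_Xhat S X W) =
  s * binary_entropy (cascade p x) + (1 - s) * binary_entropy (cascade p y).
Proof.
have rE u v : law_S_Xhat S X W (u, v) = (if v then s else 1 - s) *
    bernoulli_pmf (cascade p (if v then x else y)) u.
  rewrite (law_S_XhatE hS hindep) -!(law_X_XhatE hS hindep) !qE !hS1 /cascade.
  by case: u; case: v => /=; ring.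
have mrE v : marg2 (law_S_Xhat S X W) v = if v then s else 1 - s.
  by rewrite /marg2 big_bool/= !rE/= -mulrDr subrKC mulr1.
rewrite cond_entropy_bool big_bool/= !mrE !rE/=; congr (_ + _).
- have [->|s0] := eqVneq s 0; first by rewrite !mul0r.
  by rewrite (mulrC s (cascade _ _)) mulfK.
- have [->|s0] := eqVneq (1 - s) 0; first by rewrite !mul0r.
  by rewrite (mulrC (1 - s) (cascade _ _)) mulfK.
Qed.

Lemma mutual_info_posteriors : is_channel W ->
  mutual_info (law_X_Xhat S X W) =
  binary_entropy b - (s * binary_entropy x + (1 - s) * binary_entropy y).
Proof.
move=> [W0 W1]; rewrite mutual_infoE; last first.
  by move=> [u v]; rewrite (law_X_XhatE hS hindep) mulr_ge0// law_ge0.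
have m1E u : marg1 (law_X_Xhat S X W) u = bernoulli_pmf b u.
  rewrite -hX -[RHS]mulr1 -(W1 u) mulr_sumr; apply: eq_bigr => v _.
  exact: law_X_XhatE hS hindep _ _ _.
rewrite entropy_bool ?m1E/= ?subrKC//; congr (_ - _).
rewrite cond_entropy_bool big_bool/= !mE !qE/=; congr (_ + _).
- have [->|s0] := eqVneq s 0; first by rewrite !mul0r.
  by rewrite (mulrC s x) mulfK.
- have [->|s0] := eqVneq (1 - s) 0; first by rewrite !mul0r.
  by rewrite (mulrC (1 - s) y) mulfK.
Qed.

End evaluation.

Lemma cond_entropy_S_ge W : is_channel W ->
  binary_entropy p <= cond_entropy (law_S_Xhat S X W).
Proof.
move=> /channel_has_posteriors[s [x [y [sI xI yI sxy]]]].
rewrite (cond_entropy_S_posteriors sxy).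
have s0 : 0 <= s by lra.
have s1 : 0 <= 1 - s by lra.
have h1 := ler_wpM2l s0 (binary_entropy_cascade_ge hp xI).
have h2 := ler_wpM2l s1 (binary_entropy_cascade_ge hp yI).
lra.
Qed.

Lemma mutual_info_ge0 W : is_channel W -> 0 <= mutual_info (law_X_Xhat S X W).
Proof.
move=> cW; have [s [x [y [sI xI yI sxy]]]] := channel_has_posteriors cW.
rewrite (mutual_info_posteriors sxy)// subr_ge0.
have -> : b = s * x + (1 - s) * y by case: sxy => h1 _ h2 _; rewrite -h1 -h2;
  case: cW => _ /(_ true); rewrite big_bool/= -mulrDr => ->; rewrite mulr1.
exact: binary_entropy_concave.
Qed.

(** Fano's inequality: 1 - x and y are the error probabilities given each output and their mean is
    the distortion, so concavity and monotonicity up to 1/2 apply. *)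
Lemma mutual_info_ge_distortion W (D : R) : is_channel W ->
  expected_distortion S X W <= D -> D <= 2^-1 ->
  binary_entropy b - binary_entropy D <= mutual_info (law_X_Xhat S X W).
Proof.
move=> cW; have [s [x [y [sI xI yI sxy]]]] := channel_has_posteriors cW.
rewrite (distortion_posteriors sxy) (mutual_info_posteriors sxy)// => eD D2.
rewrite lerD2l lerN2 -(binary_entropy_sym x).
have xI' : 0 <= 1 - x <= 1 by lra.
apply: le_trans (binary_entropy_concave sI xI' yI) _.
have h1 : 0 <= s * (1 - x) by rewrite mulr_ge0; lra.
have h2 : 0 <= (1 - s) * y by rewrite mulr_ge0; lra.
by apply: binary_entropy_le => //; rewrite addr_ge0.
Qed.

Lemma mutual_info_ge_leakage W (c : R) : is_channel W -> 0 <= c <= 2^-1 ->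
  cond_entropy (law_S_Xhat S X W) <= binary_entropy (cascade p c) ->
  binary_entropy b - binary_entropy c <= mutual_info (law_X_Xhat S X W).
Proof.
move=> cW cI; have [s [x [y [sI xI yI sxy]]]] := channel_has_posteriors cW.
rewrite (cond_entropy_S_posteriors sxy) (mutual_info_posteriors sxy)// => h.
by rewrite lerD2l lerN2 (mrs_gerber_le hp).
Qed.

(* The test channel is the one whose reverse channel, from [X^] to [X], is binary
   symmetric with crossover probability [c]. *)
Lemma reverse_bsc_channel (c : R) : 0 <= c <= b -> b <= 2^-1 -> exists W,
  [/\ is_channel W, expected_distortion S X W = c,
      cond_entropy (law_S_Xhat S X W) = binary_entropy (cascade p c) &
      mutual_info (law_X_Xhat S X W) = binary_entropy b - binary_entropy c].
Proof.
(* [s] solves s (1 - c) + (1 - s) c = b. If c = 1/2 then b = 1/2, and the default value s = 0 of the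
   quotient still solves it. *)
move=> cI b2; pose s := (b - c) / (1 - 2 * c).
have [sI sE] : 0 <= s <= 1 /\ s * (1 - c) + (1 - s) * c = b.
  rewrite /s; have [c2|c2] := eqVneq c 2^-1.
    by rewrite c2 mulfV// subrr invr0 mulr0; lra.
  have c0 : 0 < 1 - 2 * c.
    have : c < 2^-1 by rewrite lt_neqAle c2/=; lra.
    lra.
  split; last by field; rewrite gt_eqF.
  by rewrite divr_ge0 ?(ltW c0) ?subr_ge0/= ?ler_pdivrMr//; lra.
have xI : 0 <= 1 - c <= 1 by lra.
have yI : 0 <= c <= 1 by lra.
have [W cW sxy] := has_posteriors_channel sI xI yI sE.
exists W; split => //.
- by rewrite (distortion_posteriors sxy); ring.
- by rewrite (cond_entropy_S_posteriors sxy) cascadeB !binary_entropy_sym; ring.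
- by rewrite (mutual_info_posteriors sxy)// binary_entropy_sym; ring.
Qed.

End channels.

(** * Infeasibility and the three regimes of the rate *)

Theorem theorem1 (R : realType) (d : measure_display) (T : measurableType d)
    (P : probability T R) (X S1 S : {RV P >-> bool}) (a p1 D C : R)
    (ha : 0 <= a <= 2^-1) (hp1 : 0 <= p1 < 2^-1)
    (hS : forall w, S w = X w (+) S1 w)
    (hindep : independent_RV X S1)
    (hS1 : is_bernoulli S1 p1) (hSa : is_bernoulli S a)
    (hD : 0 <= D) (hC : 0 <= C <= 1) :
  let b := Num.min ((a - p1) / (1 - 2 * p1)) (1 - (a - p1) / (1 - 2 * p1)) in
  let C1 := (binary_entropy_inv C - p1) / (1 - 2 * p1) in
  (C < entropy (law P S1) -> ~ exists W, feasible S X D C W) /\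
  (entropy (law P S1) <= C ->
    [/\ C1 <= D -> C1 <= b ->
          is_rate S X D C (binary_entropy b - binary_entropy C1),
        D < C1 -> D <= b ->
          is_rate S X D C (binary_entropy b - binary_entropy D) &
        b < Num.min D C1 ->
          is_rate S X D C 0]).
Proof.
move=> b C1.
have k0 : 0 < 1 - 2 * p1 by lra.
have HS1 : entropy (law P S1) = binary_entropy p1.
  by rewrite entropy_bool ?hS1//= subrKC.
pose q := law P X true.
have hX : is_bernoulli X q.
  by case => //=; have := law_RV_sum X; rewrite -/q; lra.
have qI := is_bernoulli_ge0le1 hX.
have aE : a = cascade p1 q.
  have := law_xor hS hindep true; rewrite hSa !hX !hS1/= => ->.
  by rewrite /cascade; ring.
(* The formula for b inverts the cascade, and a <= 1/2 forces q <= 1/2, so the minimum is its first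
   argument. *)
have bE : b = q.
  have -> : b = Num.min q (1 - q).
    rewrite /b aE /cascade; congr Num.min; by field; rewrite gt_eqF.
  have q2 : q <= 2^-1.
    rewrite -subr_ge0 -(pmulr_rge0 _ k0); move: ha; rewrite aE /cascade; lra.
  rewrite min_l//; lra.
have b2 : b <= 2^-1.
  rewrite bE -subr_ge0 -(pmulr_rge0 _ k0); move: ha; rewrite aE /cascade; lra.
rewrite -bE in hX qI; rewrite HS1; split.
  move=> CH [W [cW _ HC]].
  by have := cond_entropy_S_ge hS hindep hp1 hS1 hX cW; lra.
move=> HC; have [iI iE] := binary_entropy_invK hC.
have pi : p1 <= binary_entropy_inv C.
  by apply: binary_entropy_le_inv; rewrite ?iE//; lra.
(* Hence C = H(cascade p1 C1), the form of the leakage bound that Mrs. Gerber's lemma takes. *)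
have C1E : cascade p1 C1 = binary_entropy_inv C.
  by rewrite /cascade /C1; field; rewrite gt_eqF.
have C1I : 0 <= C1 <= 2^-1.
  by apply/andP; split; [rewrite divr_ge0; lra|rewrite ler_pdivrMr//; lra].
clearbody C1 b.
(* Used with c equal to C1, D and b in the three cases. Leakage is nondecreasing in c, so c <= C1
   meets the constraint. *)
have achieve c : 0 <= c -> c <= b -> c <= D -> c <= C1 ->
    rates S X D C (binary_entropy b - binary_entropy c).
  move=> c0 cb cD cC1.
  have [|W [cW eW HW IW]] := reverse_bsc_channel hS hindep hS1 hX (c := c) _ b2.
    by rewrite c0.
  exists W => //; split => //; first by rewrite eW.
  rewrite HW -iE -C1E.
  have h1 : 0 <= (1 - 2 * p1) * c by rewrite mulr_ge0; lra.
  have h2 : 0 <= (1 - 2 * p1) * (C1 - c) by rewrite mulr_ge0; lra.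
  by apply: binary_entropy_le; rewrite ?C1E; move: C1E; rewrite /cascade; lra.
split=> [C1D C1b|DC1 Db|].
- split; first by apply: achieve => //; lra.
  move=> _ [W [cW eW HW] <-].
  by apply: (mutual_info_ge_leakage hS hindep hp1 hS1 hX cW C1I); rewrite C1E iE.
- split; first by apply: achieve => //; lra.
  move=> _ [W [cW eW HW] <-].
  by apply: (mutual_info_ge_distortion hS hindep hX cW eW); lra.
- rewrite lt_min => /andP[bD bC1]; split.
    (* With c = b the achieved rate is H(b) - H(b) = 0. *)
    by rewrite -(subrr (binary_entropy b)); apply: achieve => //; lra.
  move=> _ [W [cW eW HW] <-].
  exact: (mutual_info_ge0 hS hindep hX cW).
Qed.
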